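(* Let $\mathbf J_1:M\to\mathfrak g_1^*$ and $\mathbf J_2:M\to\mathfrak g_2^*$ be two infinitesimally equivariant momentum maps for two symplectic Lie algebra actions of $\mathfrak g_1$ and $\mathfrak g_2$ on the symplectic manifold $(M,\omega)$ (possibly infinite dimensional). Assume that $(\mathfrak g_2)_M\subset\ker T\mathbf J_1$ (i.e. $\mathbf J_1$ is infinitesimally $\mathfrak g_2$-invariant). Then this is equivalent to $(\mathfrak g_1)_M\subset\ker T\mathbf J_2$ (i.e. $\mathbf J_2$ is infinitesimally $\mathfrak g_1$-invariant), and also to the statement $\omega(\xi_M,\eta_M)=0$ for all $\xi\in\mathfrak g_1$ and $\eta\in\mathfrak g_2$. Moreover the pair of momentum maps $$\mathfrak g_1^*\xleftarrow{\ \mathbf J_1\ }(M,\omega)\xrightarrow{\ \mathbf J_2\ }\mathfrak g_2^*$$ is a weak dual pair and the Lie algebra actions commute: $[\xi_M,\eta_M]=0$ for all $\xi\in\mathfrak g_1$ and $\eta\in\mathfrak g_2$. If in addition the Lie algebra action of $\mathfrak g_2$ is transitive on level sets of $\mathbf J_1$ and the Lie algebra action of $\mathfrak g_1$ is transitive on level sets of $\mathbf J_2$, that is, $$(\mathfrak g_2)_M=\ker T\mathbf J_1\quad\text{and}\quad(\mathfrak g_1)_M=\ker T\mathbf J_2,$$ then this pair is a dual pair.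
   Context: $M$ is a (Fréchet) manifold with a possibly weak symplectic form $\omega$ (closed, with trivial kernel at each point). For an action of a Lie algebra $\mathfrak g$ on $M$, $\xi_M$ is the infinitesimal generator of $\xi\in\mathfrak g$, and $(\mathfrak g)_M(m)=\{\xi_M(m):\xi\in\mathfrak g\}\subset T_mM$; (in)equalities between such subspaces are meant at every $m\in M$. $\mathfrak g^*$ is a topological vector space in nondegenerate duality with $\mathfrak g$. A momentum map $\mathbf J:M\to\mathfrak g^*$ satisfies $\mathbf d\langle\mathbf J,\xi\rangle=\mathbf i_{\xi_M}\omega$ for all $\xi\in\mathfrak g$; it is infinitesimally equivariant if $\langle\mathbf J,[\xi,\eta]\rangle=\omega(\xi_M,\eta_M)$ (left action), resp. $-\langle\mathbf J,[\xi,\eta]\rangle=\omega(\xi_M,\eta_M)$ (right action), for all $\xi,\eta\in\mathfrak g$. Infinitesimally equivariant momentum maps are formally Poisson. For $V\subset T_mM$, $V^\omega=\{w\in T_mM:\omega(v,w)=0\ \forall v\in V\}$. A pair of such maps $(\mathbf J_1,\mathbf J_2)$ is a weak dual pair if $(\ker T\mathbf J_1)^\omega\subset\ker T\mathbf J_2$ and $(\ker T\mathbf J_2)^\omega\subset\ker T\mathbf J_1$, and a dual pair if $(\ker T\mathbf J_1)^\omega=\ker T\mathbf J_2$ and $(\ker T\mathbf J_2)^\omega=\ker T\mathbf J_1$. *)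

(* Defs.v *)
From HB Require Import structures.
From mathcomp Require Import all_boot all_order all_algebra.
From mathcomp Require Import all_classical all_reals all_analysis.
Set Implicit Arguments.
Unset Strict Implicit.
Unset Printing Implicit Defensive.
Import Order.TTheory GRing.Theory Num.Theory.
Import numFieldNormedType.Exports.
Local Open Scope classical_set_scope.
Local Open Scope ring_scope.

(* [tvsType R] bundles a locally convex space with a uniform structure that is
   only required to induce the topology, so the Cauchy filters are taken here
   with respect to the translation-invariant uniformity.  The existence of a
   countable basis of neighbourhoods of 0 amounts to metrizability. *)
Definition frechet_space (R : realType) (E : tvsType R) : Prop :=
  [/\ hausdorff_space E,
      exists B : nat -> set E, (forall n, nbhs (0 : E) (B n)) /\
        forall V : set E, nbhs (0 : E) V -> exists n, B n `<=` V
    & forall F : set_system E, ProperFilter F ->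
        (forall V : set E, nbhs (0 : E) V ->
           exists2 A, F A & forall x y, A x -> A y -> V (x - y)) ->
        exists l : E, F --> l].

Section Calculus.
Variable R : realType.

(* [derive] and [derivable] of the library are restricted to normed modules. *)
Definition diff_quotient (E F : topologicalLmodType R) (f : E -> F) (x v : E)
  (t : R) : F := t^-1 *: (f (x + t *: v) - f x).

Definition gateaux_derivable (E F : topologicalLmodType R) (f : E -> F)
    (x v : E) : Prop :=
  exists l : F, diff_quotient f x v t @[t --> 0^'] --> l.

Definition gateaux (E F : topologicalLmodType R) (f : E -> F) (x v : E) : F :=
  xget 0 [set l : F | diff_quotient f x v t @[t --> 0^'] --> l].

(* C^k maps on an open set U in the sense of Michal-Bastiani (Keller's C^k_c,
   Hamilton's C^k): f is C^(k+1) on U when its directional derivatives exist,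
   are linear in the direction, and (x, v) |-> Df(x)v is C^k on U x E. *)
Fixpoint Ck_on (k : nat) (E : tvsType R) (F : topologicalLmodType R)
    (U : set E) (f : E -> F) : Prop :=
  (forall x, U x -> {for x, continuous f}) /\
  if k is k'.+1 then
    (forall x, U x -> (forall v, gateaux_derivable f x v) /\
                      linear (gateaux f x)) /\
    Ck_on k' (U `*` [set: E]) (fun p : E * E => gateaux f p.1 p.2)
  else True.

Definition smooth_on (E : tvsType R) (F : topologicalLmodType R)
  (U : set E) (f : E -> F) : Prop := forall k, Ck_on k U f.

End Calculus.

(* Hausdorff manifold with an atlas of charts valued in Fréchet spaces; as in
   Hamilton's definition, the model space may depend on the chart.  A chart is
   a total function, meaningful on its domain only, and likewise for its
   inverse.  The preferred chart [chart_at m] around each point m carries no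
   extra structure: it serves to represent the tangent space at m. *)
Record frechet_manifold (R : realType) := FrechetManifold {
  man_carrier :> topologicalType;
  atlas : Type;
  model : atlas -> tvsType R;
  dom : atlas -> set man_carrier;
  chart : forall i, man_carrier -> model i;
  chart_inv : forall i, model i -> man_carrier;
  chart_at : man_carrier -> atlas;
  man_hausdorff : hausdorff_space man_carrier;
  model_frechet : forall i, frechet_space (model i);
  dom_open : forall i, open (dom i);
  cod_open : forall i, open (chart i @` dom i);
  chartK : forall i m, dom i m -> chart_inv (chart i m) = m;
  chart_continuous : forall i m, dom i m -> {for m, continuous (chart i)};
  chart_inv_continuous : forall i x, (chart i @` dom i) x ->
    {for x, continuous (@chart_inv i)};
  dom_chart_at : forall m, dom (chart_at m) m;
  transition_smooth : forall i j,
    smooth_on ((chart i @` dom i) `&` (@chart_inv i @^-1` dom j))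
              (chart j \o @chart_inv i)
}.
Arguments atlas {R} M : rename.
Arguments model {R M} i : rename.
Arguments dom {R M} i : rename.
Arguments chart {R M} i m : rename.
Arguments chart_inv {R M} i x : rename.
Arguments chart_at {R M} m : rename.

Section Manifold.
Variables (R : realType) (M : frechet_manifold R).

Definition cod (i : atlas M) : set (model i) := chart i @` dom i.
Arguments cod i x : clear implicits.

(* T_m M, each tangent vector being identified with its coordinates in the
   preferred chart at m. *)
Definition tangent (m : M) : tvsType R := model (chart_at m).

(* Coordinates in the chart i of a tangent vector at m, and conversely, for m
   in the domain of i. *)
Definition coord (i : atlas M) (m : M) (v : tangent m) : model i :=
  gateaux (chart i \o chart_inv (chart_at m)) (chart (chart_at m) m) v.

Definition of_coord (i : atlas M) (m : M) (u : model i) : tangent m :=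
  gateaux (chart (chart_at m) \o chart_inv i) (chart i m) u.

Definition smooth_map (F : topologicalLmodType R) (f : M -> F) : Prop :=
  forall i : atlas M, smooth_on (cod i) (f \o chart_inv i).

(* T_m f : T_m M -> F, which is the differential df when F = R. *)
Definition tangent_map (F : topologicalLmodType R) (f : M -> F) (m : M)
    (v : tangent m) : F :=
  gateaux (f \o chart_inv (chart_at m)) (chart (chart_at m) m) v.

Definition kerT (F : topologicalLmodType R) (f : M -> F) (m : M) :
  set (tangent m) := [set v | tangent_map f v = 0].
Arguments kerT {F} f m.

Definition vector_field := forall m : M, tangent m.

Definition vf_loc (X : vector_field) (i : atlas M) (x : model i) : model i :=
  coord i (X (chart_inv i x)).
Arguments vf_loc X i x : clear implicits.

Definition smooth_vf (X : vector_field) : Prop :=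
  forall i : atlas M, smooth_on (cod i) (vf_loc X i).

(* Jacobi-Lie bracket; in a chart, [X, Y] = DY.X - DX.Y. *)
Definition vf_bracket (X Y : vector_field) : vector_field := fun m =>
  let c := chart_at m in let x := chart c m in
  gateaux (vf_loc Y c) x (vf_loc X c x) -
  gateaux (vf_loc X c) x (vf_loc Y c x).

Definition form_field := forall m : M, tangent m -> tangent m -> R.

Section TwoForm.
Variable omega : form_field.

Definition form_loc (i : atlas M) (x u v : model i) : R^o :=
  omega (of_coord (chart_inv i x) u) (of_coord (chart_inv i x) v).
Arguments form_loc i x u v : clear implicits.

Definition smooth_2form : Prop :=
  [/\ forall m (v : tangent m), linear (omega v : tangent m -> R^o),
      forall m (v w : tangent m), omega v w = - omega w v
    & forall i : atlas M,
        smooth_on (cod i `*` [set: model i] `*` [set: model i])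
          (fun p : model i * model i * model i => form_loc i p.1.1 p.1.2 p.2)].

Definition closed_2form : Prop :=
  forall (i : atlas M) (x u v w : model i), cod i x ->
    gateaux (fun y => form_loc i y v w) x u
    - gateaux (fun y => form_loc i y u w) x v
    + gateaux (fun y => form_loc i y u v) x w = 0.

Definition weak_symplectic : Prop :=
  [/\ smooth_2form, closed_2form
    & forall m (v : tangent m), (forall w : tangent m, omega v w = 0) -> v = 0].

(* The Lie derivative of omega along X vanishes:
   (L_X omega)(u, v) = D omega(X)(u, v) + omega(DX.u, v) + omega(u, DX.v). *)
Definition symplectic_vf (X : vector_field) : Prop :=
  forall (i : atlas M) (x u v : model i), cod i x ->
    gateaux (fun y => form_loc i y u v) x (vf_loc X i x)
    + form_loc i x (gateaux (vf_loc X i) x u) v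
    + form_loc i x u (gateaux (vf_loc X i) x v) = 0.

Definition orthogonal (m : M) (V : set (tangent m)) : set (tangent m) :=
  [set w | forall v, V v -> omega v w = 0].

End TwoForm.
End Manifold.
Arguments cod {R M} i x.
Arguments kerT {R M F} f m _.
Arguments vf_loc {R M} X i x.
Arguments form_loc {R M} omega i x u v.

Record lie_algebra (R : realType) := LieAlgebra {
  lie_carrier :> lmodType R;
  lie_bracket : lie_carrier -> lie_carrier -> lie_carrier;
  lie_linearl : forall y, linear (lie_bracket ^~ y);
  lie_linearr : forall x, linear (lie_bracket x);
  lie_alternating : forall x, lie_bracket x x = 0;
  lie_jacobi : forall x y z, lie_bracket x (lie_bracket y z)
    + lie_bracket y (lie_bracket z x) + lie_bracket z (lie_bracket x y) = 0
}.

(* A topological vector space gs in nondegenerate duality with g; the topology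
   of gs is compatible with the pairing, i.e., each <-, xi> is continuous. *)
Record duality (R : realType) (gs : topologicalLmodType R) (g : lmodType R) :=
  Duality {
  pairing :> gs -> g -> R;
  pairing_linearl : forall xi, linear (pairing ^~ xi : gs -> R^o);
  pairing_linearr : forall mu, linear (pairing mu : g -> R^o);
  pairing_continuous : forall xi, continuous (pairing ^~ xi : gs -> R^o);
  pairing_separatingl : forall mu, (forall xi, pairing mu xi = 0) -> mu = 0;
  pairing_separatingr : forall xi, (forall mu, pairing mu xi = 0) -> xi = 0
}.

Variant side := LeftAction | RightAction.

Definition signed (s : side) (R : pzRingType) (V : lmodType R) (v : V) : V :=
  if s is LeftAction then v else - v.

(* With the Jacobi-Lie bracket, xi |-> xi_M is an antihomomorphism for a left
   action and a homomorphism for a right action. *)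
Record lie_action (R : realType) (M : frechet_manifold R) (g : lie_algebra R)
    (s : side) := LieAction {
  generator :> g -> vector_field M;
  generator_smooth : forall xi, smooth_vf (generator xi);
  generator_linear : forall m, linear (fun xi => generator xi m);
  generator_bracket : forall xi eta m,
    vf_bracket (generator xi) (generator eta) m =
    - signed s (generator (lie_bracket xi eta) m)
}.

Section MomentumMaps.
Variables (R : realType) (M : frechet_manifold R) (omega : form_field M).

Definition orbit_directions (g : lie_algebra R) (s : side)
  (a : lie_action M g s) (m : M) : set (tangent m) := [set a xi m | xi in setT].
Arguments orbit_directions {g s} a m _.

Definition symplectic_action (g : lie_algebra R) (s : side)
  (a : lie_action M g s) : Prop := forall xi, symplectic_vf omega (a xi).

Section OneMap.
Variables (g : lie_algebra R) (gs : topologicalLmodType R).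
Variables (d : duality gs g) (s : side) (a : lie_action M g s) (J : M -> gs).

Definition momentum_map : Prop :=
  smooth_map J /\
  forall xi m (v : tangent m),
    tangent_map (fun m' => d (J m') xi : R^o) v = omega (a xi m) v.

Definition infinitesimally_equivariant : Prop :=
  forall xi eta m,
    signed s (d (J m) (lie_bracket xi eta) : R^o) = omega (a xi m) (a eta m).

End OneMap.

Definition weak_dual_pair (F1 F2 : topologicalLmodType R)
    (J1 : M -> F1) (J2 : M -> F2) : Prop :=
  forall m : M, orthogonal omega (kerT J1 m) `<=` kerT J2 m /\
                orthogonal omega (kerT J2 m) `<=` kerT J1 m.

Definition dual_pair (F1 F2 : topologicalLmodType R)
    (J1 : M -> F1) (J2 : M -> F2) : Prop :=
  forall m : M, orthogonal omega (kerT J1 m) = kerT J2 m /\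
                orthogonal omega (kerT J2 m) = kerT J1 m.

End MomentumMaps.
Arguments orbit_directions {R M g s} a m _.

(* Main.v *)
Require Import Defs.
From HB Require Import structures.
From mathcomp Require Import all_boot all_order all_algebra.
From mathcomp Require Import all_classical all_reals all_analysis.
From mathcomp Require Import lra.
Import Order.TTheory GRing.Theory Num.Theory.
Import numFieldNormedType.Exports.
Local Open Scope classical_set_scope.
Local Open Scope ring_scope.

(** The momentum condition says that the pairing of T_m J (v) with xi is
omega(xi_M, v). As the pairing is separating, the kernel of T J is therefore
the omega-orthogonal of the orbit directions ([kerT_momentum]). With this
description in hand, each of the two invariance conditions unfolds to
omega(xi_M, eta_M) = 0 for all xi and eta, which is symmetric in the two
actions; the inclusions of a weak dual pair hold because orthogonality reverses
inclusions, and under transitivity the equalities of a dual pair are the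
description itself.

For the bracket, the usual identity i_[X,Y] omega = - d(omega(X, Y)) for
symplectic vector fields X and Y ([omega_bracket]) gives
omega([xi_M, eta_M], -) = 0, and a weakly symplectic form has trivial kernel.
In a chart, that identity follows by adding up the closedness of omega, the
vanishing of the two Lie derivatives and the Leibniz rule for
omega(X, Y) ([form_loc_leibniz]).

The analysis consists of two points. The Leibniz rule is a chain rule for a
real function of class C^1 on a locally convex space ([C1_hadamard],
[C1_chain]), which the mean value theorem on the real line provides. The chart
expression of omega(X, Y) agrees with its value on M because a tangent vector is
recovered from its coordinates in any chart ([coordK]). This asks for a chain
rule for the transition maps, whose values lie in a Fréchet space; but the
functionals omega(v, -) are continuous and separate tangent vectors, so that
composing with them reduces it to the real-valued case. *)

Set Implicit Arguments.
Unset Strict Implicit.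
Unset Printing Implicit Defensive.

(** * Calculus along lines in topological vector spaces *)

Lemma real_mean_value (R : realType) (q dq : R -> R) (t : R) :
  (forall r, `|r| <= `|t| -> is_derive r (1 : R) q (dq r)) ->
  exists2 c, `|c| <= `|t| & q t - q 0 = dq c * t.
Proof.
move=> qdq.
have cont a b : (forall r, r \in `[a, b] -> `|r| <= `|t|) ->
    {within `[a, b], continuous q}.
  move=> ab; apply: derivable_within_continuous => r /ab /qdq.
  by case.
have [t0|t0] := leP 0 t.
  have sub r : r \in `[0, t] -> `|r| <= `|t|.
    by rewrite in_itv /= => /andP[r0 rt]; rewrite !ger0_norm.
  case: (@MVT_segment _ q dq 0 t t0 _ (cont _ _ sub)) => [r|c /sub ct ->].
    by move=> /subset_itv_oo_cc/sub/qdq.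
  by exists c => //; rewrite subr0.
have sub r : r \in `[t, 0] -> `|r| <= `|t|.
  rewrite in_itv /= => /andP[tr r0].
  by rewrite !ler0_norm ?(ltW t0)// lerN2.
case: (@MVT_segment _ q dq t 0 (ltW t0) _ (cont _ _ sub)) => [r|c /sub ct].
  by move=> /subset_itv_oo_cc/sub/qdq.
rewrite -opprB => /(congr1 -%R); rewrite opprK => ->.
by exists c => //; rewrite -mulrN sub0r opprK.
Qed.

Section Calculus.
Context {R : realType}.

Lemma gateauxP (E F : topologicalLmodType R) (f : E -> F) x v :
  gateaux_derivable f x v ->
  diff_quotient f x v t @[t --> 0^'] --> gateaux f x v.
Proof. by move=> [l fl]; rewrite /gateaux; case: xgetP => [//|/(_ l)]. Qed.

Lemma cvg_gateaux (E F : topologicalLmodType R) (f : E -> F) x v l :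
  hausdorff_space F ->
  diff_quotient f x v t @[t --> 0^'] --> l -> gateaux f x v = l.
Proof.
move=> hF fl.
have fg : diff_quotient f x v t @[t --> 0^'] --> gateaux f x v.
  by apply: gateauxP; exists l.
exact: (cvg_unique hF fg fl).
Qed.

Lemma line_continuous (E : topologicalLmodType R) (x h : E) :
  {for (0 : R, h), continuous (fun p : R * E => x + p.1 *: p.2)}.
Proof.
have -> : {for (0 : R, h), continuous (fun p : R * E => x + p.1 *: p.2)} =
  (x + p.1 *: p.2 @[p --> (0 : R, h)] --> x + (0 : R) *: h) by [].
apply: (@continuous2_cvg _ _ _ _ _ _ (fun=> x)
  (fun p : R * E => p.1 *: p.2) +%R).
- exact: (@add_continuous E (x, 0 *: h)).
- exact: cvg_cst.
- exact: (@scale_continuous R E (0, h)).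
Qed.

Lemma near_line (E : topologicalLmodType R) (x v : E) (U : set E) :
  nbhs x U -> \forall t \near (0 : R)^', U (x + t *: v).
Proof.
move=> Ux; apply: nbhs_dnbhs.
have /= := @line_continuous E x v U; rewrite scale0r addr0 => /(_ Ux).
case=> -[A B] /= [A0 Bv] AB; apply: filterS A0 => t At.
by apply: (AB (t, v)); split=> //=; exact: nbhs_singleton.
Qed.

(** Gateaux derivatives alone do not obey a chain rule. A function of class C^1
is moreover differentiable along curves: by the mean value theorem the quotient
is the derivative at y + c k(t) in the direction k(t), for some c between 0 and
t, and the derivative is jointly continuous in the point and the direction. *)
Lemma C1_hadamard (E : tvsType R) (f : E -> R^o) (U : set E) (y h : E)
    (k : R -> E) :
  open U -> U y -> Ck_on 1 U f -> k t @[t --> 0^'] --> h ->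
  t^-1 *: (f (y + t *: k t) - f y) @[t --> 0^'] --> gateaux f y h.
Proof.
move=> oU Uy [_ [df [cdf _]]] kh.
have lin : (y + p.1 *: p.2, p.2) @[p --> (0 : R, h)] --> (y, h).
  apply: cvg_pair; last exact: cvg_snd.
  have := @line_continuous E y h.
  by rewrite /prop_for /continuous_at /= scale0r addr0.
have dcont :
    gateaux f (y + p.1 *: p.2) p.2 @[p --> (0 : R, h)] --> gateaux f y h.
  have fyh := cdf (y, h) (conj Uy I).
  exact: (@cvg_comp _ _ _ _ (fun p : E * E => gateaux f p.1 p.2) _ _ _ lin fyh).
have Uline : \forall p \near (0 : R, h), U (y + p.1 *: p.2).
  have /= := @line_continuous E y h U; rewrite scale0r addr0; apply.
  exact: open_nbhs_nbhs.
move=> W /= fW.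
have [[A B] /= [A0 Bh] AB] := filterI Uline (dcont _ fW).
have [e /= e0 eA] := (nbhs_ballP _ _).1 A0.
have tn0 : \forall t \near (0 : R)^', t != 0 by exact: nbhs_dnbhs_neq.
have te := @dnbhs0_lt _ R^o _ e0.
suff : \forall t \near (0 : R)^', W (t^-1 *: (f (y + t *: k t) - f y)) by [].
near=> t.
have t0 : t != 0 by near: t; exact: tn0.
have Bt : B (k t) by near: t; exact: kh.
have tlt : `|t| < e by near: t; exact: te.
have inAB r : `|r| <= `|t| -> (A `*` B) (r, k t).
  move=> rt; split => //=; apply: eA.
  by rewrite -ball_normE /= sub0r normrN (le_lt_trans rt).
pose q r : R := f (y + r *: k t).
have [r rt|c ct] :=
    @real_mean_value R q (fun r => gateaux f (y + r *: k t) (k t)) t.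
  have [Ur _] := AB _ (inAB r rt).
  have fr := gateauxP ((df _ Ur).1 (k t)).
  have qE : (fun s => s^-1 *: ((q \o shift r) (s *: (1 : R)) - q r)) =
      diff_quotient f (y + r *: k t) (k t).
    apply/funext => s; rewrite /diff_quotient /q /= [s *: 1]mulr1.
    by rewrite (addrC s) scalerDl addrA.
  split; first by rewrite /derivable qE; apply: cvgP; exact: fr.
  by rewrite /derive qE; apply: cvg_lim; [exact: norm_hausdorff|exact: fr].
rewrite /q scale0r addr0 => ->.
by rewrite /GRing.scale /= mulrC mulfK //; case: (AB _ (inAB c ct)).
Unshelve. all: by end_near.
Qed.

Lemma diff_quotientE (E F : topologicalLmodType R) (f : E -> F) x v t :
  t != 0 -> f x + t *: diff_quotient f x v t = f (x + t *: v).
Proof.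
by move=> t0; rewrite /diff_quotient scalerA divff // scale1r addrC subrK.
Qed.

Lemma C1_chain (E : topologicalLmodType R) (F : tvsType R) (f : E -> F)
    (g : F -> R^o) (U : set F) (x v : E) (h : F) :
  open U -> U (f x) -> Ck_on 1 U g ->
  diff_quotient f x v t @[t --> 0^'] --> h ->
  diff_quotient (g \o f) x v t @[t --> 0^'] --> gateaux g (f x) h.
Proof.
move=> oU Ufx C1g fh.
have gh := C1_hadamard oU Ufx C1g fh.
apply: cvg_trans gh; apply: near_eq_cvg.
have tn0 : \forall t \near (0 : R)^', t != 0 by exact: nbhs_dnbhs_neq.
by apply: filterS tn0 => t t0; rewrite diff_quotientE.
Qed.

Lemma eq_near_diff_quotient (E F : topologicalLmodType R) (f g : E -> F)
    (x v : E) (l : F) :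
  {near x, f =1 g} ->
  diff_quotient f x v t @[t --> 0^'] --> l ->
  diff_quotient g x v t @[t --> 0^'] --> l.
Proof.
move=> fg fl; apply: cvg_trans fl; apply: near_eq_cvg.
apply: filterS (near_line v fg) => t fgt.
by rewrite /diff_quotient fgt (nbhs_singleton fg).
Qed.

Lemma eq_near_gateaux (E F : topologicalLmodType R) (f g : E -> F) (x v : E) :
  {near x, f =1 g} -> gateaux f x v = gateaux g x v.
Proof.
move=> fg; congr xget; apply/seteqP; split => l;
  apply: eq_near_diff_quotient => //.
by apply: filterS fg.
Qed.

(** A Gateaux derivative only sees the function along one line, which turns a
partial derivative of a function on a product into a derivative on a factor. *)
Lemma eq_line_gateaux (E E' F : topologicalLmodType R) (f : E -> F)
    (g : E' -> F) (x v : E) (x' v' : E') :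
  (forall t : R, f (x + t *: v) = g (x' + t *: v')) ->
  gateaux f x v = gateaux g x' v'.
Proof.
move=> fg; rewrite /gateaux.
have := fg 0; rewrite !scale0r !addr0 => fg0.
suff -> : diff_quotient f x v = diff_quotient g x' v' by [].
by apply/funext => t; rewrite /diff_quotient fg fg0.
Qed.

Lemma diff_quotient_linear (E F : topologicalLmodType R) (L : E -> F) x v :
  linear L -> diff_quotient L x v t @[t --> 0^'] --> L v.
Proof.
move=> linL.
have tn0 : \forall t \near (0 : R)^', t != 0 by exact: nbhs_dnbhs_neq.
have Lv : L v @[_ --> (0 : R)^'] --> L v by exact: cvg_cst.
apply: cvg_trans Lv; apply: near_eq_cvg; apply: filterS tn0 => t t0.
by rewrite /diff_quotient (addrC x) linL addrK scalerA mulVf // scale1r.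
Qed.

Lemma gateaux_linear (E F : topologicalLmodType R) (L : E -> F) x v :
  hausdorff_space F -> linear L -> gateaux L x v = L v.
Proof.
move=> hF linL; apply: (cvg_gateaux hF); exact: diff_quotient_linear.
Qed.

Lemma diff_quotient_comp_linear (E F G : topologicalLmodType R) (L : F -> G)
    (f : E -> F) x v :
  linear L -> continuous L -> gateaux_derivable f x v ->
  diff_quotient (L \o f) x v t @[t --> 0^'] --> L (gateaux f x v).
Proof.
move=> linL cL df.
have -> : diff_quotient (L \o f) x v = L \o diff_quotient f x v.
  apply/funext => t; rewrite /diff_quotient /= (scalable_linear linL).
  by rewrite (zmod_morphism_linear linL).
by apply: continuous_cvg; [exact: cL|exact: gateauxP].
Qed.

Lemma C1_comp_linear (E : tvsType R) (F G : topologicalLmodType R) (L : F -> G)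
    (f : E -> F) (U : set E) :
  hausdorff_space G -> linear L -> continuous L -> open U ->
  Ck_on 1 U f -> Ck_on 1 U (L \o f).
Proof.
move=> hG linL cL oU [cf [df [cdf _]]].
have dLf x v : U x -> gateaux (L \o f) x v = L (gateaux f x v).
  move=> Ux; apply: cvg_gateaux => //.
  by apply: diff_quotient_comp_linear => //; exact: (df x Ux).1.
split; first by move=> x Ux; apply: continuous_comp; [exact: cf|exact: cL].
split.
  move=> x Ux; split=> [v|a u w]; last by rewrite !dLf// (df x Ux).2 linL.
  exists (L (gateaux f x v)).
  by apply: diff_quotient_comp_linear => //; exact: (df x Ux).1.
split=> // p Up.
have : {for p, continuous (L \o (fun p : E * E => gateaux f p.1 p.2))}.
  by apply: continuous_comp; [exact: cdf|exact: cL].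
rewrite /prop_for /continuous_at /= dLf; last exact: Up.1.
apply: cvg_trans; apply: near_eq_cvg.
have : nbhs p.1 U by apply: open_nbhs_nbhs; split => //; exact: Up.1.
move=> Up1; exists (U, setT) => /=; first by split=> //; exact: filterT.
by move=> q [/= Uq _]; rewrite dLf.
Qed.

End Calculus.

(** * Tangent vectors and forms in charts *)

Section Charts.
Context {R : realType} {M : frechet_manifold R}.
Implicit Types (i j : atlas M) (n : M).

Lemma cod_chart_at n : cod (chart_at n) (chart (chart_at n) n).
Proof. by exists n => //; exact: dom_chart_at. Qed.

Lemma dom_chart_inv i (x : model i) : cod i x -> dom i (chart_inv i x).
Proof. by move=> [n din <-]; rewrite chartK. Qed.

Lemma chart_invK i (x : model i) : cod i x -> chart i (chart_inv i x) = x.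
Proof. by move=> [n din <-]; rewrite chartK. Qed.

Definition overlap i j : set (model i) := cod i `&` chart_inv i @^-1` dom j.
Arguments overlap i j : clear implicits.

Lemma overlap_open i j : open (overlap i j).
Proof.
rewrite openE => x [codx domx]; apply: filterI.
  by apply: open_nbhs_nbhs; split=> //; exact: cod_open.
apply: (chart_inv_continuous codx); apply: open_nbhs_nbhs.
by split=> //; exact: dom_open.
Qed.

Lemma overlap_chart i j n : dom i n -> dom j n -> overlap i j (chart i n).
Proof. by move=> din djn; split; [exists n|rewrite /preimage /= chartK]. Qed.

Lemma transition_C1 i j : Ck_on 1 (overlap i j) (chart j \o chart_inv i).
Proof. exact: (transition_smooth i j 1%N). Qed.

(** Tangent vectors at n are, by definition, their coordinates in the preferred
chart at n. *)
Lemma of_coord_chart_at n (u : tangent n) : of_coord (i := chart_at n) n u = u.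
Proof.
set c := chart_at n.
have near_id : {near chart c n, chart c \o chart_inv c =1 id}.
  have : nbhs (chart c n) (cod c).
    by apply: open_nbhs_nbhs; split; [exact: cod_open|exact: cod_chart_at].
  by apply: filterS => x codx; rewrite /= chart_invK.
rewrite /of_coord (eq_near_gateaux _ near_id).
by apply: (gateaux_linear (L := id)) => //; case: (model_frechet c).
Qed.

Lemma of_coord_linear i n : dom i n -> linear (@of_coord _ _ i n).
Proof.
move=> din; have [_ [dtr _]] := transition_C1 i (chart_at n).
exact: (dtr _ (overlap_chart din (dom_chart_at n))).2.
Qed.

Section Form.
Variable omega : form_field M.
Arguments omega : clear implicits.
Hypothesis omegaP : weak_symplectic omega.

Let omega_linear n v : linear (omega n v : tangent n -> R^o).
Proof. by case: omegaP => -[]. Qed.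

Let omega_anti n v w : omega n v w = - omega n w v.
Proof. by case: omegaP => -[]. Qed.

Lemma form_locE i n u v : dom i n ->
  form_loc omega i (chart i n) u v = omega n (of_coord n u) (of_coord n v).
Proof. by move=> din; rewrite /form_loc chartK. Qed.

Lemma form_loc_linearr i x u : cod i x -> linear (form_loc omega i x u).
Proof.
move=> codx a v w; rewrite /form_loc (of_coord_linear (dom_chart_inv codx)).
exact: omega_linear.
Qed.

Lemma form_loc_anti i x u v : form_loc omega i x u v = - form_loc omega i x v u.
Proof. exact: omega_anti. Qed.

Lemma form_loc_linearl i x v : cod i x -> linear ((form_loc omega i x)^~ v).
Proof.
move=> codx a u w.
rewrite 3!(form_loc_anti _ _ v) (form_loc_linearr _ codx).
by rewrite scalerN opprD.
Qed.

(** In the preferred chart at n, omega(v, -) is a partial function of the local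
expression of omega, which is jointly continuous. *)
Lemma omega_continuous n v : continuous (omega n v : tangent n -> R^o).
Proof.
move=> w; set c := chart_at n.
have [[_ _ /(_ c 0%N)[contF _]] _ _] := omegaP.
have := contF (chart c n, v, w) (conj (conj (cod_chart_at n) I) I).
have -> : (omega n v : tangent n -> R^o) =
  (fun p : model c * model c * model c => form_loc omega c p.1.1 p.1.2 p.2) \o
    (fun u => (chart c n, v, u)).
  apply/funext => u /=.
  by rewrite /c /= form_locE; [rewrite !of_coord_chart_at|exact: dom_chart_at].
move=> contn; apply: continuous_comp; last exact: contn.
have pairw : (chart c n, v, u) @[u --> w] --> (chart c n, v, w).
  apply: (@cvg_pair _ _ _ (nbhs w) (nbhs (chart c n, v)) (nbhs w)).
    exact: cvg_cst.
  exact: cvg_id.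
exact: pairw.
Qed.

(** The two changes of chart are inverse to each other, hence so should be their
derivatives. It suffices to test this against the functionals omega(v, -), which
separate tangent vectors; after composition with one of them the transition map
is real-valued, and the chain rule applies. *)
Lemma coordK i n (w : tangent n) : dom i n -> of_coord n (Defs.coord i w) = w.
Proof.
move=> din; set c := chart_at n.
have dcn : dom c n := dom_chart_at n.
have [_ [dtr _]] := transition_C1 c i.
have coordP := gateauxP ((dtr _ (overlap_chart dcn din)).1 w).
have [_ [dti _]] := transition_C1 i c.
have nearK : {near chart c n,
    (chart c \o chart_inv i) \o (chart i \o chart_inv c) =1 id}.
  have : nbhs (chart c n) (overlap c i).
    apply: open_nbhs_nbhs; split; first exact: overlap_open.
    exact: overlap_chart.
  by apply: filterS => x [codx domx] /=; rewrite chartK //= chart_invK.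
apply/eqP; rewrite -subr_eq0; apply/eqP; case: omegaP => _ _; apply => v.
rewrite omega_anti (zmod_morphism_linear (@omega_linear n v)).
suff -> : omega n v (of_coord n (Defs.coord i w)) = omega n v w.
  by rewrite subrr oppr0.
have hR : hausdorff_space R^o by exact: norm_hausdorff.
have chart_n : (chart i \o chart_inv c) (chart c n) = chart i n.
  by rewrite /= chartK.
have C1v : Ck_on 1 (overlap i c)
    (omega n v \o (chart c \o chart_inv i) : _ -> R^o).
  apply: (C1_comp_linear hR (@omega_linear n v) (@omega_continuous n v)).
    exact: overlap_open.
  exact: transition_C1.
have ovl : overlap i c ((chart i \o chart_inv c) (chart c n)).
  by rewrite chart_n; exact: overlap_chart.
have := C1_chain (overlap_open i c) ovl C1v coordP.
rewrite chart_n => lim_chain.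
have lim_coord : diff_quotient (omega n v : tangent n -> R^o) (chart c n) w t
    @[t --> 0^'] --> (omega n v (of_coord n (Defs.coord i w)) : R^o).
  have <- : gateaux (omega n v \o (chart c \o chart_inv i) : _ -> R^o)
      (chart i n) (Defs.coord i w) = omega n v (of_coord n (Defs.coord i w)).
    apply: (cvg_gateaux hR); apply: diff_quotient_comp_linear.
    - exact: omega_linear.
    - exact: omega_continuous.
    - exact: (dti _ (overlap_chart din dcn)).1.
  apply: eq_near_diff_quotient lim_chain.
  by apply: filterS nearK => x xK /=; congr (omega n v _); exact: xK.
have lim_w : diff_quotient (omega n v : tangent n -> R^o) (chart c n) w t
    @[t --> 0^'] --> (omega n v w : R^o).
  by apply: diff_quotient_linear; exact: omega_linear.
exact: (cvg_unique hR lim_coord lim_w).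
Qed.

Lemma form_loc_vf i x (X Y : vector_field M) : cod i x ->
  form_loc omega i x (vf_loc X i x) (vf_loc Y i x) =
  omega _ (X (chart_inv i x)) (Y (chart_inv i x)).
Proof.
by move=> codx; rewrite /form_loc /vf_loc !coordK //; exact: dom_chart_inv.
Qed.

Lemma form_loc_C1 i : Ck_on 1 (cod i `*` [set: model i] `*` [set: model i])
  (fun p : model i * model i * model i => form_loc omega i p.1.1 p.1.2 p.2).
Proof. by case: omegaP => -[_ _ smooth _ _]; exact: (smooth i 1%N). Qed.

Lemma smooth_vf_derivable (X : vector_field M) i x v :
  smooth_vf X -> cod i x -> gateaux_derivable (vf_loc X i) x v.
Proof.
by move=> smX codx; have [_ [dX _]] := smX i 1%N; exact: (dX x codx).1.
Qed.

(** The chain rule for y |-> (y, X y, Y y) followed by the local expression of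
omega. The derivative of the latter at (x, X x, Y x) is linear, so it splits
into the three partial derivatives; the last two are the values of the form
itself, which is linear in each vector. *)
Lemma form_loc_leibniz i x v (X Y : model i -> model i) :
  cod i x -> gateaux_derivable X x v -> gateaux_derivable Y x v ->
  gateaux (fun y => form_loc omega i y (X y) (Y y)) x v =
  gateaux (fun y => form_loc omega i y (X x) (Y x)) x v +
  form_loc omega i x (gateaux X x v) (Y x) +
  form_loc omega i x (X x) (gateaux Y x v).
Proof.
move=> codx dX dY.
set E := model i.
set F := fun p : E * E * E => form_loc omega i p.1.1 p.1.2 p.2.
have hR : hausdorff_space R^o by exact: norm_hausdorff.
set U := cod i `*` [set: E] `*` [set: E].
have oU : open U.
  have -> : U = (fun p : E * E * E => p.1.1) @^-1` cod i.
    by apply/seteqP; split=> [p [[]]|p]//=.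
  apply: open_comp; last exact: cod_open.
  move=> p _; apply: (@continuous_comp _ _ _ fst fst); exact: cvg_fst.
have C1F : Ck_on 1 U F by exact: form_loc_C1.
pose f y : E * E * E := (y, X y, Y y).
have fv :
    diff_quotient f x v t @[t --> 0^'] --> (v, gateaux X x v, gateaux Y x v).
  apply: (@cvg_pair _ _ _ _ (nbhs (v, gateaux X x v)) (nbhs (gateaux Y x v))).
    apply: (@cvg_pair _ _ _ _ (nbhs v) (nbhs (gateaux X x v))).
      exact: (@diff_quotient_linear R E E id x v).
    exact: (gateauxP dX).
  exact: (gateauxP dY).
have Uf : U (f x) by [].
rewrite (cvg_gateaux hR (C1_chain oU Uf C1F fv)).
have [_ [dF _]] := C1F; have [_ linF] := dF _ Uf.
have linFD u w :
    gateaux F (f x) (u + w) = gateaux F (f x) u + gateaux F (f x) w.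
  by rewrite -[u]scale1r linF !scale1r.
have -> : (v, gateaux X x v, gateaux Y x v) =
    (v, 0, 0) + (0, gateaux X x v, 0) + (0, 0, gateaux Y x v) :> E * E * E.
  by congr (_, _, _) => /=; rewrite ?add0r ?addr0.
rewrite (linFD ((v, 0, 0) + (0, _, 0)) (0, 0, _)) (linFD (v, 0, 0) (0, _, 0)).
have -> : gateaux F (f x) (v, 0, 0) =
    gateaux (fun y => form_loc omega i y (X x) (Y x)) x v.
  by apply: eq_line_gateaux => t; rewrite /F /f /= !scaler0 !addr0.
have -> : gateaux F (f x) (0, gateaux X x v, 0) =
    form_loc omega i x (gateaux X x v) (Y x).
  rewrite -(gateaux_linear (X x) (gateaux X x v) hR
    (form_loc_linearl (Y x) codx)).
  by apply: eq_line_gateaux => t; rewrite /F /f /= !scaler0 !addr0.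
have -> : gateaux F (f x) (0, 0, gateaux Y x v) =
    form_loc omega i x (X x) (gateaux Y x v).
  rewrite -(gateaux_linear (Y x) (gateaux Y x v) hR
    (form_loc_linearr (X x) codx)).
  by apply: eq_line_gateaux => t; rewrite /F /f /= !scaler0 !addr0.
by [].
Qed.

(** In the preferred chart at m, subtract the vanishing of L_X omega (Y, v) from
that of L_Y omega (X, v): the bracket appears as DY.X - DX.Y, closedness turns
the two derivatives of omega into D omega(v)(X, Y), and the Leibniz rule
identifies the sum of the remaining terms with the differential of
omega(X, Y). *)
Lemma omega_bracket (X Y : vector_field M) m (v : tangent m) :
  smooth_vf X -> smooth_vf Y ->
  symplectic_vf omega X -> symplectic_vf omega Y ->
  omega m (vf_bracket X Y m) v =
  - tangent_map (fun m' => omega m' (X m') (Y m') : R^o) v.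
Proof.
move=> smX smY spX spY; have [_ closed _] := omegaP.
set c := chart_at m; set x := chart c m.
have codx : cod c x by exact: cod_chart_at.
have -> : omega m (vf_bracket X Y m) v =
    form_loc omega c x (vf_bracket X Y m) v.
  rewrite /x form_locE; last exact: dom_chart_at.
  by rewrite /c !of_coord_chart_at.
have -> : tangent_map (fun m' => omega m' (X m') (Y m') : R^o) v =
    gateaux (fun y => form_loc omega c y (vf_loc X c y) (vf_loc Y c y)) x v.
  apply: eq_near_gateaux.
  have : nbhs x (cod c) by apply: open_nbhs_nbhs; split=> //; exact: cod_open.
  by apply: filterS => y cody; rewrite /= form_loc_vf.
rewrite form_loc_leibniz //; try exact: smooth_vf_derivable.
rewrite /vf_bracket -/c -/x (zmod_morphism_linear (form_loc_linearl v codx)).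
have := spX c x (vf_loc Y c x) v codx.
have := spY c x (vf_loc X c x) v codx.
have := closed c x (vf_loc X c x) (vf_loc Y c x) v codx.
rewrite (form_loc_anti x (gateaux (vf_loc X c) x v) (vf_loc Y c x)).
(* dA, dB and dC are the derivatives of the form along X, Y and v; p and q the
   two halves of the bracket term; r and s involve DY.v and DX.v. *)
have arith (dA dB dC p q r s : R) : dA - dB + dC = 0 -> dB + p + r = 0 ->
    dA + q + s = 0 -> p - q = - (dC - s + r) by lra.
exact: arith.
Qed.
End Form.
End Charts.

(** * Kernels of momentum maps *)

Section Momentum.
Context {R : realType} {M : frechet_manifold R} (omega : form_field M).
Context {g : lie_algebra R} {gs : topologicalLmodType R} (d : duality gs g).
Context {s : side} (a : lie_action M g s) (J : M -> gs).
Hypothesis J_momentum : momentum_map omega d a J.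

(** Each <-, xi> is continuous and linear, so it commutes with the derivative
of J. *)
Lemma pairing_tangent_map xi m (v : tangent m) :
  d (tangent_map J v) xi = tangent_map (fun m' => d (J m') xi : R^o) v.
Proof.
have [smJ _] := J_momentum.
have [_ [dJ _]] := smJ (chart_at m) 1%N.
have Jv := (dJ _ (cod_chart_at m)).1 v.
apply/esym/cvg_gateaux; first exact: norm_hausdorff.
exact: (diff_quotient_comp_linear (pairing_linearl d xi)
  (@pairing_continuous _ _ _ d xi) Jv).
Qed.

(** Since <T J (v), xi> = omega(xi_M, v) and the pairing separates the points
of the target of J. *)
Lemma kerT_momentum m :
  kerT J m = Defs.orthogonal omega (orbit_directions a m).
Proof.
have [_ dJ] := J_momentum.
apply/seteqP; split=> [v Jv _ [xi _ <-]|v orth_v].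
  rewrite -dJ -pairing_tangent_map Jv.
  by rewrite -(subrr 0) (zmod_morphism_linear (pairing_linearl d xi)) subrr.
apply: (pairing_separatingl (d := d)) => xi.
by rewrite pairing_tangent_map dJ; apply: orth_v; exists xi.
Qed.
End Momentum.

(** * The dual pair *)

Theorem proposition2p1 (R : realType) (M : frechet_manifold R)
  (omega : form_field M) (omega_symplectic : weak_symplectic omega)
  (g1 g2 : lie_algebra R) (g1s g2s : topologicalLmodType R)
  (d1 : duality g1s g1) (d2 : duality g2s g2)
  (s1 s2 : side) (a1 : lie_action M g1 s1) (a2 : lie_action M g2 s2)
  (a1_symplectic : symplectic_action omega a1)
  (a2_symplectic : symplectic_action omega a2)
  (J1 : M -> g1s) (J2 : M -> g2s)
  (J1_momentum : momentum_map omega d1 a1 J1)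
  (J2_momentum : momentum_map omega d2 a2 J2)
  (J1_equivariant : infinitesimally_equivariant omega d1 a1 J1)
  (J2_equivariant : infinitesimally_equivariant omega d2 a2 J2) :
  let invariant1 := forall m : M, orbit_directions a2 m `<=` kerT J1 m in
  let invariant2 := forall m : M, orbit_directions a1 m `<=` kerT J2 m in
  [/\ invariant1 <-> invariant2,
      invariant1 <->
        (forall (xi : g1) (eta : g2) (m : M), omega m (a1 xi m) (a2 eta m) = 0)
    & invariant1 ->
        [/\ weak_dual_pair omega J1 J2,
            forall (xi : g1) (eta : g2) (m : M),
              vf_bracket (a1 xi) (a2 eta) m = 0
          & (forall m : M, orbit_directions a2 m = kerT J1 m) /\
            (forall m : M, orbit_directions a1 m = kerT J2 m) ->
            dual_pair omega J1 J2]].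
Proof.
move=> invariant1 invariant2.
have [[_ omega_anti _] _ nondeg] := omega_symplectic.
have ker1 := kerT_momentum J1_momentum.
have ker2 := kerT_momentum J2_momentum.
have inv1E : invariant1 <->
    (forall xi eta m, omega m (a1 xi m) (a2 eta m) = 0).
  split=> [inv xi eta m|orth m _ [eta _ <-]].
    have /inv : orbit_directions a2 m (a2 eta m) by exists eta.
    by rewrite ker1; apply; exists xi.
  by rewrite ker1 => _ [xi _ <-].
have inv2E : invariant2 <->
    (forall xi eta m, omega m (a1 xi m) (a2 eta m) = 0).
  split=> [inv xi eta m|orth m _ [xi _ <-]].
    have /inv : orbit_directions a1 m (a1 xi m) by exists xi.
    rewrite ker2 omega_anti => orth2.
    by rewrite orth2 ?oppr0 //; exists eta.
  by rewrite ker2 => _ [eta _ <-]; rewrite omega_anti orth oppr0.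
split=> //; first by rewrite inv1E inv2E.
move=> inv1; have inv2 : invariant2 by apply/inv2E/inv1E.
split.
- move=> m; split=> w orth_w.
    by rewrite ker2 => v /inv1; exact: orth_w.
  by rewrite ker1 => v /inv2; exact: orth_w.
- move=> xi eta m; apply: nondeg => v.
  rewrite (omega_bracket omega_symplectic) //; try exact: generator_smooth.
  have -> : (fun m' => omega m' (a1 xi m') (a2 eta m') : R^o) = fun=> 0.
    by apply/funext => m'; exact: inv1E.1.
  (* The derivative of a constant, seen as the linear map 0. *)
  suff -> : tangent_map (fun=> 0 : R^o) v = 0 by rewrite oppr0.
  apply: (gateaux_linear (L := fun=> 0 : R^o)); first exact: norm_hausdorff.
  by move=> a u w; rewrite scaler0 addr0.
- move=> [trans1 trans2] m; split.
    by rewrite -trans1 ker2.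
  by rewrite -trans2 ker1.
Qed.
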